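(* Let $N\ge1$, $\theta>0$, and let $\mathcal{L}$ be a probability measure on $\mathbb{C}^*$. If $M_N$ follows the distribution $\mathbb{P}(N,\theta,\mathcal{L})$, then the expectation $\tilde\mu_N$ of the random measure $\mu(M_N)$ is $$\tilde\mu_N=\theta\sum_{k=1}^N\frac{N(N-1)\cdots(N-k+1)}{(N-1+\theta)(N-2+\theta)\cdots(N-k+\theta)}\,\mathcal{L}_k.$$
   Context: $\Sigma_N$ is the group of permutations of $\{1,\dots,N\}$. For $\sigma\in\Sigma_N$ and $z_1,\dots,z_N\in\mathbb{C}^*$, $M(\sigma,z_1,\dots,z_N)$ is the $N\times N$ matrix $M$ with entries $M_{jk}=z_j\mathbf{1}_{j=\sigma(k)}$. $\mathbb{P}(N,\theta,\mathcal{L})$ is the law of $M(\sigma,z_1,\dots,z_N)$ where $\sigma$ follows the Ewens measure of parameter $\theta$ on $\Sigma_N$ (each permutation has probability proportional to $\theta^n$, $n$ its number of cycles), $z_1,\dots,z_N$ have law $\mathcal{L}$, and $\sigma,z_1,\dots,z_N$ are independent. $\mu(M)=\sum_\lambda m_M(\lambda)\delta_\lambda$ is the sum over the eigenvalues $\lambda$ of $M$ with multiplicity $m_M(\lambda)$; its expectation is $\tilde\mu_N(A)=\mathbb{E}[\mu(M_N)(A)]$ for Borel $A\subset\mathbb{C}$. For $k\ge1$, $\mathcal{L}_k$ is the unique probability measure on $\mathbb{C}^*$ which is invariant under multiplication by $k$-th roots of unity and whose image under $z\mapsto z^k$ is the multiplicative convolution of $k$ copies of $\mathcal{L}$ (i.e.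 the law of a product of $k$ independent variables of law $\mathcal{L}$). *)

(* Defs.v *)
From HB Require Import structures.
From mathcomp Require Import all_boot all_order all_algebra all_fingroup.
From mathcomp Require Import complex.
From mathcomp Require Import all_classical all_reals all_analysis.

Set Implicit Arguments.
Unset Strict Implicit.
Unset Printing Implicit Defensive.

Import Order.TTheory GRing.Theory Num.Theory.
Import numFieldNormedType.Exports.

Local Open Scope classical_set_scope.
Local Open Scope ring_scope.
Local Open Scope complex_scope.

(* The Borel sigma-algebra of C, the topology being that of the modulus. *)
Definition complex_open (R : realType) : set (set R[i]) :=
  @open (R[i] : numFieldType).

HB.instance Definition _ (R : realType) := isPointed.Build R[i] 0.

HB.instance Definition _ (R : realType) :=
  @isMeasurable.Build (sigma_display (@complex_open R)) R[i]
    <<s @complex_open R >> (@sigma_algebra0 _ _ _)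
    (@sigma_algebraC _ _) (@sigma_algebra_bigcup _ _ _).

Record Cstar (R : realType) := MkCstar { cval :> R[i]; cval_neq0 : cval != 0 }.

HB.instance Definition _ (R : realType) := [isSub for @cval R].
HB.instance Definition _ (R : realType) := [Choice of Cstar R by <:].
HB.instance Definition _ (R : realType) :=
  isPointed.Build (Cstar R) (MkCstar (oner_neq0 R[i])).

Definition cval_preimage (R : realType) : set (set (Cstar R)) :=
  preimage_set_system setT (@cval R) measurable.

HB.instance Definition _ (R : realType) :=
  @isMeasurable.Build (sigma_display (@cval_preimage R)) (Cstar R)
    <<s @cval_preimage R >> (@sigma_algebra0 _ _ _)
    (@sigma_algebraC _ _) (@sigma_algebra_bigcup _ _ _).

(* Matrices carry the product sigma-algebra of their entries. *)
Definition entry_cylinders d (T : measurableType d) (m n : nat) :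
    set (set 'M[T]_(m, n)) :=
  [set B | exists i j, exists2 A : set T, measurable A &
    B = [set M : 'M[T]_(m, n) | A (M i j)]].

HB.instance Definition _ d (T : measurableType d) (m n : nat) :=
  @isMeasurable.Build (sigma_display (@entry_cylinders d T m n)) 'M[T]_(m, n)
    <<s @entry_cylinders d T m n >> (@sigma_algebra0 _ _ _)
    (@sigma_algebraC _ _) (@sigma_algebra_bigcup _ _ _).

HB.instance Definition _ (T : finType) :=
  isPointed.Build (perm_type T) (perm_one T).

HB.instance Definition _ (T : finType) :=
  @isMeasurable.Build default_measure_display (perm_type T)
    discrete_measurable discrete_measurable0
    discrete_measurableC discrete_measurableU.

Section ewens.
Context (R : realType) (N : nat) (theta : {posnum R}).

Definition ewens_pmf (s : 'S_N) : R :=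
  theta%:num ^+ #|porbits s| / \sum_(t : 'S_N) theta%:num ^+ #|porbits t|.

Definition ewens (A : set 'S_N) : \bar R :=
  (\sum_(s : 'S_N) (ewens_pmf s)%:E * \d_s A)%E.

Let weight_ge0 (s : 'S_N) : 0 <= theta%:num ^+ #|porbits s|.
Proof. by rewrite exprn_ge0. Qed.

Let total_gt0 : 0 < \sum_(t : 'S_N) theta%:num ^+ #|porbits t|.
Proof.
rewrite (bigD1 1%g)//= ltr_pwDl ?exprn_gt0//.
by apply: sumr_ge0.
Qed.

Let ewens_pmf_ge0 s : 0 <= ewens_pmf s.
Proof. by rewrite divr_ge0// ltW. Qed.

Let ewens0 : ewens set0 = 0%E.
Proof. by rewrite /ewens big1// => s _; rewrite measure0 mule0. Qed.

Let ewens_ge0 A : (0 <= ewens A)%E.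
Proof. by apply: sume_ge0 => s _; rewrite mule_ge0// lee_fin. Qed.

Let ewens_sigma_additive : semi_sigma_additive ewens.
Proof.
move=> F mF tF mUF; rewrite /ewens.
under eq_fun do rewrite exchange_big/=.
apply: cvg_nnesum => s _.
  by apply: nearW => n; apply: sume_ge0 => k _; rewrite mule_ge0// lee_fin.
under eq_fun do rewrite -ge0_sume_distrr//.
by apply: cvgeZl => //; exact: measure_semi_sigma_additive.
Qed.

HB.instance Definition _ := isMeasure.Build _ _ _ ewens
  ewens0 ewens_ge0 ewens_sigma_additive.

Let ewens_setT : ewens [set: 'S_N] = 1%E.
Proof.
rewrite /ewens; under eq_bigr do rewrite diracT mule1.
by rewrite sumEFin -mulr_suml divff// gt_eqF.
Qed.

HB.instance Definition _ := Measure_isProbability.Build _ _ _ ewens ewens_setT.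

End ewens.

Section iid.
Context d (T : measurableType d) (R : realType).

Definition tuple_cons n (x : T * n.-tuple T) : n.+1.-tuple T :=
  [tuple of x.1 :: x.2].

Let measurable_tuple_cons n : measurable_fun [set: T * n.-tuple T] (@tuple_cons n).
Proof. exact: measurable_cons. Qed.

HB.instance Definition _ n :=
  isMeasurableFun.Build _ _ _ _ (@tuple_cons n) (@measurable_tuple_cons n).

Fixpoint iid (L : probability T R) n : probability (n.-tuple T) R :=
  if n is m.+1 then distribution (L \x iid L m)%E (@tuple_cons m)
  else \d_[tuple].

End iid.

Section random_permutation_matrix.
Context (R : realType).

Definition perm_cmx N (s : 'S_N) (z : N.-tuple (Cstar R)) : 'M[R[i]]_N :=
  \matrix_(j, k) (if j == s k then cval (tnth z j) else 0).

(* The product measure makes the permutation and the N coefficients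
   independent. *)
Definition perm_cmx_law N (theta : {posnum R}) (L : probability (Cstar R) R) :
    set 'M[R[i]]_N -> \bar R :=
  pushforward (ewens theta \x iid L N)%E (fun x => perm_cmx x.1 x.2).

(* Algebraic multiplicities; the sum has finite support. *)
Definition eigen_measure N (M : 'M[R[i]]_N) (A : set R[i]) : \bar R :=
  (\sum_(l \in [set l | eigenvalue M l])
     ((mup l (char_poly M))%:R : R)%:E * \d_l A)%E.

Definition expected_eigen_measure d (Omega : measurableType d)
    (P : probability Omega R) N (M : Omega -> 'M[R[i]]_N) (A : set R[i]) :
    \bar R :=
  (\int[P]_w eigen_measure (M w) A)%E.

Definition mulconv_pow (L : probability (Cstar R) R) k : set R[i] -> \bar R :=
  pushforward (iid L k) (fun t => \prod_(i < k) cval (tnth t i)).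

Definition is_root_law (L : probability (Cstar R) R) k
    (nu : probability (Cstar R) R) : Prop :=
  (forall zeta : R[i], zeta ^+ k = 1 -> forall A : set R[i], measurable A ->
     pushforward nu (fun z => zeta * cval z) A = pushforward nu (@cval R) A) /\
  (forall A : set R[i], measurable A ->
     pushforward nu (fun z => cval z ^+ k) A = mulconv_pow L k A).

(* For 0 < k exactly one measure satisfies [is_root_law L k]; [get] selects
   it. *)
Definition root_law (L : probability (Cstar R) R) k : probability (Cstar R) R :=
  get [set nu | is_root_law L k nu].

End random_permutation_matrix.

(* Main.v *)
Require Import Defs.
From HB Require Import structures.
From mathcomp Require Import all_boot all_order all_algebra all_fingroup.
From mathcomp Require Import separable cyclotomic complex ring lra.
From mathcomp Require Import all_classical all_reals all_analysis.
From mathcomp Require Import measurable_realfun.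

(** The eigenvalues of a weighted permutation matrix are read off its cycles.
The characteristic polynomial is the product over the cycles [C] of
[X^|C| - w_C], with [w_C] the product of the coefficients met along [C]
([char_poly_perm_cmx]); so the spectral measure is the sum over the cycles of
the counting measure of the [|C|]-th roots of [w_C] ([eigen_measure_perm_cmx]).

Conditionally on the permutation, [w_C] is a product of [k = |C|] independent
variables of law [L] ([integral_iid_prod]). Its k-th roots, taken together,
have mean measure [k] times any law which is invariant under k-th roots of unity
and whose image by the k-th power is the law of [w_C] ([integral_root_count]).
Such a law exists ([is_root_law_average]), so that [root_law L k] is one
([root_lawP]). The conditional expectation is therefore the sum over the points
[j] of [root_law L k], where [k] is the length of the cycle of [j].

It remains to compute the law of this length under the Ewens measure. Inserting
a new point into a permutation of [n] points either adds a fixed point, with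
weight [theta], or lengthens an existing cycle in [n] ways. This gives the
normalising constant [theta (theta + 1) ... (theta + n - 1)]
([sum_theta_cycles]) and, as all points play the same role, a recursion for the
expected number of points in cycles of length [k] ([cycle_statS]), solved in
[cycle_statE].

Two points of measure theory need care. A measurable choice of k-th roots is
built explicitly from polar coordinates ([rootc]). And the hypothesis only
concerns the law of [M_N], while the eigenvalue count of an arbitrary matrix is
not shown to be a measurable function; it is replaced by the measurable function
[cycle_root_count], which agrees with it on the permutation matrices, up to the
null event that [M_N] is not one of them ([integral_eq_off_null]). *)

Set Implicit Arguments.
Unset Strict Implicit.
Unset Printing Implicit Defensive.

Import Order.TTheory GRing.Theory Num.Theory.
Import numFieldNormedType.Exports.

Local Open Scope classical_set_scope.
Local Open Scope ring_scope.
Local Open Scope complex_scope.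

(** * Inserting a point into a permutation *)

Section insertion.
Variable n : nat.
Implicit Types (t : 'S_n) (i : 'I_n) (j : 'I_n.+1).

Local Notation L := (lift (@ord0 n)).

(** For [j = lift ord0 i] the cycle of [i] becomes [i -> ord0 -> t i], so that
[ord0] is inserted right after [i]; for [j = ord0] the new point is fixed. *)
Definition extend_perm j t : 'S_n.+1 :=
  (tperm ord0 j * lift_perm ord0 ord0 t)%g.

(** The parameter [j] is recovered as the preimage of [ord0]; equality of
cardinals then yields surjectivity. *)
Lemma extend_perm_bij :
  bijective (fun x : 'I_n.+1 * 'S_n => extend_perm x.1 x.2).
Proof.
apply: inj_card_bij; last by rewrite card_prod !card_Sn card_ord factS.
move=> [j t] [j' t'] /= E.
have jj' : j = j'.
  have := congr1 (fun s : 'S_n.+1 => s^-1%g ord0) E.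
  rewrite /extend_perm !invMg !permM !lift_permV !lift_perm_id !tpermV.
  by rewrite !tpermL.
rewrite -jj' in E *; congr (_, _).
move/mulgI: E => E; apply/permP => x; apply: (@lift_inj _ (@ord0 n)).
by rewrite -!(lift_perm_lift (@ord0 n)) E.
Qed.

Lemma sum_extend_perm (V : nmodType) (F : 'S_n.+1 -> V) :
  \sum_s F s = \sum_j \sum_t F (extend_perm j t).
Proof.
rewrite (reindex _ (onW_bij _ extend_perm_bij)) /=.
by rewrite (pair_bigA _ (fun j t => F (extend_perm j t))).
Qed.

Lemma extend_perm0 t : extend_perm ord0 t = lift_perm ord0 ord0 t.
Proof. by rewrite /extend_perm tperm1 mul1g. Qed.

Lemma extend_perm_lift i t x :
  extend_perm (L i) t (L x) = if x == i then ord0 else L (t x).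
Proof.
rewrite permM; case: eqVneq => [->|xi]; first by rewrite tpermR lift_perm_id.
rewrite tpermD ?lift_perm_lift// ?neq_lift//.
by rewrite (inj_eq lift_inj) eq_sym.
Qed.

Lemma extend_perm_ord0 i t : extend_perm (L i) t ord0 = L (t i).
Proof. by rewrite permM tpermL lift_perm_lift. Qed.

End insertion.

(** A cycle is the smallest stable set containing any of its points. *)
Lemma porbit_sub (T : finType) (s : {perm T}) (S : {set T}) x :
  x \in S -> (forall y, y \in S -> s y \in S) -> porbit s x \subset S.
Proof.
move=> xS sS; apply/fintype.subsetP => _ /porbitP[i ->].
by elim: i => [|i ih]; rewrite ?perm1// expgSr permM sS.
Qed.

Lemma porbit_step (T : finType) (s : {perm T}) x y :
  (s y \in porbit s x) = (y \in porbit s x).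
Proof.
by rewrite -!eq_porbit_mem; have /= := porbit_perm s 1 y; rewrite expg1 => ->.
Qed.

Section insertion_orbits.
Variable n : nat.
Implicit Types (t : 'S_n) (i : 'I_n) (C : {set 'I_n}).
Local Notation L := (lift (@ord0 n)).

Definition extend_cycle i C : {set 'I_n.+1} :=
  if i \in C then ord0 |: (L @: C) else L @: C.

Lemma mem_liftset C x : (L x \in L @: C) = (x \in C).
Proof. by rewrite mem_imset//; exact: lift_inj. Qed.

Lemma ord0_liftset C : ord0 \in L @: C = false.
Proof. by apply/negP => /imsetP[x _ /eqP]; rewrite (negbTE (neq_lift _ _)). Qed.

Lemma lift_extend_cycle i C x : (L x \in extend_cycle i C) = (x \in C).
Proof.
rewrite /extend_cycle; case: ifP => iC; last exact: mem_liftset.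
by rewrite !inE mem_liftset eq_sym (negbTE (neq_lift _ _)).
Qed.

Lemma ord0_extend_cycle i C : (ord0 \in extend_cycle i C) = (i \in C).
Proof.
by rewrite /extend_cycle; case: ifP => iC; rewrite ?ord0_liftset// !inE eqxx.
Qed.

Lemma extend_cycle_inj i : injective (extend_cycle i).
Proof.
by move=> C D E; apply/setP => x; rewrite -(lift_extend_cycle i) E lift_extend_cycle.
Qed.

Lemma card_extend_cycle i C : #|extend_cycle i C| = ((i \in C) + #|C|)%N.
Proof.
rewrite /extend_cycle; case: ifP => iC; last by rewrite card_imset//; exact: lift_inj.
by rewrite cardsU1 ord0_liftset card_imset//; exact: lift_inj.
Qed.

(** The right side is stable under the extended permutation, which gives one
inclusion. Conversely every step [y -> t y] is either a step of the extended
permutation or, when [y = i], two steps of it passing through [ord0]. *)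
Lemma porbit_extend_lift i t x :
  porbit (extend_perm (L i) t) (L x) = extend_cycle i (porbit t x).
Proof.
set s := extend_perm _ _; apply/eqP; rewrite finset.eqEsubset; apply/andP; split.
  apply: porbit_sub; first by rewrite lift_extend_cycle porbit_id.
  move=> y; case: (unliftP ord0 y) => [z|] ->.
    rewrite lift_extend_cycle extend_perm_lift; case: eqVneq => [->|_].
      by rewrite ord0_extend_cycle.
    by rewrite lift_extend_cycle porbit_step.
  by rewrite ord0_extend_cycle extend_perm_ord0 lift_extend_cycle porbit_step.
have H y : y \in porbit t x -> L y \in porbit s (L x).
  move=> /porbitP[k ->]; elim: k => [|k ih]; first by rewrite perm1 porbit_id.
  rewrite expgSr permM; set z := (t ^+ k)%g x in ih *.
  have [zi|zi] := eqVneq z i.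
    rewrite zi in ih *.
    rewrite -extend_perm_ord0 porbit_step.
    by rewrite -porbit_step /s extend_perm_lift eqxx in ih.
  by rewrite -porbit_step /s extend_perm_lift (negbTE zi) in ih.
apply/fintype.subsetP => y; case: (unliftP ord0 y) => [z|] ->.
  by rewrite lift_extend_cycle; exact: H.
rewrite ord0_extend_cycle => /H Li.
by rewrite -porbit_step /s extend_perm_lift eqxx in Li.
Qed.

Lemma porbit_extend_ord0 i t :
  porbit (extend_perm (L i) t) ord0 = extend_cycle i (porbit t i).
Proof.
rewrite -porbit_extend_lift; apply/eqP; rewrite eq_porbit_mem.
by rewrite -porbit_step extend_perm_ord0 porbit_extend_lift lift_extend_cycle
  porbit_step porbit_id.
Qed.

Lemma porbits_extend_lift i t :
  porbits (extend_perm (L i) t) = extend_cycle i @: porbits t.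
Proof.
apply/setP => C; apply/imsetP/imsetP => [[x _ ->]|[D /imsetP[x _ ->] ->]].
  case: (unliftP ord0 x) => [z|] ->.
    by exists (porbit t z); rewrite ?porbit_extend_lift// imset_f.
  by exists (porbit t i); rewrite ?porbit_extend_ord0// imset_f.
by exists (L x); rewrite ?porbit_extend_lift.
Qed.

Lemma porbit_lift_perm t x :
  porbit (lift_perm ord0 ord0 t) (L x) = L @: porbit t x.
Proof.
set s := lift_perm _ _ _; apply/eqP; rewrite finset.eqEsubset; apply/andP; split.
  apply: porbit_sub; first by rewrite mem_liftset porbit_id.
  move=> y; case: (unliftP ord0 y) => [z|] ->; last by rewrite ord0_liftset.
  by rewrite lift_perm_lift !mem_liftset porbit_step.
apply/fintype.subsetP => _ /imsetP[_ /porbitP[k ->] ->].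
elim: k => [|k ih]; first by rewrite perm1 porbit_id.
by rewrite expgSr permM -(lift_perm_lift ord0) porbit_step.
Qed.

Lemma porbit_lift_perm_ord0 t : porbit (lift_perm ord0 ord0 t) ord0 = [set ord0]%SET.
Proof.
apply/eqP; rewrite finset.eqEsubset finset.sub1set porbit_id andbT; apply: porbit_sub.
  by rewrite inE.
by move=> y; rewrite !inE => /eqP ->; rewrite lift_perm_id.
Qed.

Lemma porbits_lift_perm t :
  porbits (lift_perm ord0 ord0 t) =
  ([set ord0] |: [set L @: C | C : {set 'I_n} in porbits t])%SET.
Proof.
apply/setP => C; rewrite !inE; apply/imsetP/orP => [[x _ ->]|].
  case: (unliftP ord0 x) => [z|] ->; last first.
    by left; rewrite porbit_lift_perm_ord0.
  by right; rewrite porbit_lift_perm imset_f// imset_f.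
case=> [/eqP->|/imsetP[D /imsetP[x _ ->] ->]].
  by exists ord0; rewrite ?porbit_lift_perm_ord0.
by exists (L x); rewrite ?porbit_lift_perm.
Qed.

Section big.
Context (U : Type) (idx : U) (op : Monoid.com_law idx) (F : {set 'I_n.+1} -> U).

Lemma big_porbits_extend_lift i t :
  \big[op/idx]_(C in porbits (extend_perm (L i) t)) F C =
  \big[op/idx]_(C in porbits t) F (extend_cycle i C).
Proof.
rewrite porbits_extend_lift big_imset//= => C D _ _; exact: extend_cycle_inj.
Qed.

Lemma big_porbits_lift_perm t :
  \big[op/idx]_(C in porbits (lift_perm ord0 ord0 t)) F C =
  op (F [set ord0]%SET) (\big[op/idx]_(C in porbits t) F (L @: C)).
Proof.
rewrite porbits_lift_perm big_setU1/=; last first.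
  apply/imsetP => -[C _ E]; have := set11 (@ord0 n).
  by rewrite E ord0_liftset.
by rewrite big_imset//= => C D _ _; apply: imset_inj; exact: lift_inj.
Qed.

End big.

Lemma card_porbits_extend_lift i t :
  #|porbits (extend_perm (L i) t)| = #|porbits t|.
Proof. by rewrite porbits_extend_lift card_imset//; exact: extend_cycle_inj. Qed.

Lemma card_porbits_lift_perm t :
  #|porbits (lift_perm ord0 ord0 t)| = #|porbits t|.+1.
Proof. by rewrite -!sum1_card big_porbits_lift_perm /= add1n. Qed.

End insertion_orbits.

(** * Cycle counts under the Ewens weights *)

Lemma porbit_conj (T : finType) (s : {perm T}) (g : {perm T}) x :
  porbit (s ^ g)%g (g x) = g @: porbit s x.
Proof.
apply/setP => y; apply/porbitP/imsetP => [[i ->]|[z /porbitP[i ->] ->]].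
  by exists ((s ^+ i)%g x); rewrite ?mem_porbit// -conjXg permJ.
by exists i; rewrite -conjXg permJ.
Qed.

Lemma card_porbits_conj (T : finType) (s : {perm T}) (g : {perm T}) :
  #|porbits (s ^ g)%g| = #|porbits s|.
Proof.
have -> : porbits (s ^ g)%g = [set g @: C | C : {set T} in porbits s]%SET.
  apply/setP => C; apply/imsetP/imsetP => [[x _ ->]|[D /imsetP[x _ ->] ->]].
    exists (porbit s ((g^-1)%g x)); first exact: imset_f.
    by rewrite -porbit_conj permKV.
  by exists (g x); rewrite ?porbit_conj.
by rewrite card_imset//; apply: imset_inj; exact: perm_inj.
Qed.

Section cycle_statistics.
Variables (K : comNzRingType) (theta : K).

Definition rising n : K := \prod_(i < n) (theta + i%:R).

(** Of the [n.+1] ways of inserting a point, exactly one creates a cycle. *)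
Lemma sum_theta_cycles n : \sum_(s : 'S_n) theta ^+ #|porbits s| = rising n.
Proof.
elim: n => [|n ih].
  rewrite /rising big_ord0 (big_pred1 1%g)/=; last first.
    by move=> s; apply/esym/eqP/permP => -[].
  rewrite (_ : porbits _ = finset.set0) ?cards0 ?expr0//.
  by apply/setP => C; rewrite inE; apply/negP => /imsetP[[]].
rewrite sum_extend_perm big_ord_recl /rising big_ord_recr/= -/(rising n) -ih.
rewrite mulrDr; congr (_ + _).
  under eq_bigr do rewrite extend_perm0 card_porbits_lift_perm exprS.
  by rewrite -mulr_sumr mulrC.
under eq_bigr do under eq_bigr do rewrite card_porbits_extend_lift.
by rewrite sumr_const card_ord mulr_natr.
Qed.

(** Summing over points rather than over cycles weighs a cycle of length [k] by
[k], which is the mass that it contributes to the spectral measure. *)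
Definition cycle_stat n (v : nat -> K) : K :=
  \sum_(s : 'S_n) theta ^+ #|porbits s| * \sum_(j < n) v #|porbit s j|.

Lemma sum_porbit_conj n (v : nat -> K) (i j : 'I_n) :
  \sum_(s : 'S_n) theta ^+ #|porbits s| * v #|porbit s i| =
  \sum_(s : 'S_n) theta ^+ #|porbits s| * v #|porbit s j|.
Proof.
rewrite [RHS](reindex_inj (@conjg_inj _ (tperm i j))) /=.
apply: eq_bigr => s _; rewrite card_porbits_conj.
have -> : porbit (s ^ tperm i j)%g j = tperm i j @: porbit s i.
  by rewrite -porbit_conj tpermL.
by rewrite (card_imset _ (@perm_inj _ (tperm i j))).
Qed.

(** By conjugation invariance all points contribute as [ord0] does. Either
[ord0] is a fixed point, or its cycle is that of the point after which it was
inserted, made longer by one. *)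
Lemma cycle_statS n (v : nat -> K) :
  cycle_stat n.+1 v =
  n.+1%:R * (theta * rising n * v 1%N + cycle_stat n (v \o succn)).
Proof.
rewrite /cycle_stat; under eq_bigr do rewrite mulr_sumr.
rewrite exchange_big /=.
under eq_bigr => j _ do rewrite (sum_porbit_conj v j ord0).
rewrite sumr_const card_ord mulr_natl; congr (_ *+ _).
rewrite sum_extend_perm big_ord_recl; congr (_ + _).
  under eq_bigr do rewrite extend_perm0 card_porbits_lift_perm
    porbit_lift_perm_ord0 cards1 exprS.
  by rewrite -mulr_suml -mulr_sumr sum_theta_cycles.
rewrite exchange_big /=; apply: eq_bigr => t _; rewrite mulr_sumr.
apply: eq_bigr => j _; rewrite card_porbits_extend_lift porbit_extend_ord0.
by rewrite card_extend_cycle porbit_id.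
Qed.

Lemma cycle_statE n (v : nat -> K) :
  cycle_stat n v =
  theta * \sum_(k < n) (n ^_ k.+1)%:R * rising (n - k.+1) * v k.+1.
Proof.
elim: n v => [|n ih] v.
  rewrite /cycle_stat big_ord0 mulr0 big1// => s _.
  by rewrite big_ord0 mulr0.
rewrite cycle_statS ih big_ord_recl ffactn1 subSS subn0 !mulrDr.
congr (_ + _); first by ring.
rewrite mulrCA; congr (_ * _); rewrite mulr_sumr; apply: eq_bigr => k _.
by rewrite /= /bump/= add1n subSS ffactSS natrM !mulrA.
Qed.

End cycle_statistics.

(** * The characteristic polynomial of a weighted permutation matrix *)

Lemma eq_ord0_lift n (x : 'I_n) : (ord0 == lift ord0 x) = false.
Proof. by rewrite (negbTE (neq_lift _ _)). Qed.

Lemma eq_lift_ord0 n (x : 'I_n) : (lift ord0 x == ord0) = false.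
Proof. by rewrite eq_sym eq_ord0_lift. Qed.

Section weighted_det.
Variable K : comNzRingType.

(** Keeping the diagonal weights arbitrary, and not all equal to the
indeterminate, is what makes the induction on the size possible: removing a
point from a cycle amounts to cancelling one weight of the smaller matrix. *)
Definition weighted_perm_mx n (s : 'S_n) (a z : 'I_n -> K) : 'M[K]_n :=
  \matrix_(j, k) (a j *+ (j == k) - z j *+ (j == s k)).

Local Notation L := (lift ord0).

Lemma det_row0_delta n (B : 'M[K]_n.+1) :
  (forall k, B ord0 k = (k == ord0)%:R) -> \det B = \det (row' ord0 (col' ord0 B)).
Proof.
move=> B0; rewrite (expand_det_row _ ord0) (bigD1 ord0)//= big1 => [|k k0].
  by rewrite B0 eqxx mul1r addr0 /cofactor expr0 mul1r.
by rewrite B0 (negbTE k0) mul0r.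
Qed.

Lemma det_weighted_perm_lift n (t : 'S_n) (a z : 'I_n.+1 -> K) :
  \det (weighted_perm_mx (lift_perm ord0 ord0 t) a z) =
  (a ord0 - z ord0) * \det (weighted_perm_mx t (a \o L) (z \o L)).
Proof.
rewrite (expand_det_row _ ord0) (bigD1 ord0)//= big1 => [|k k0].
  rewrite addr0 mxE lift_perm_id eqxx /cofactor expr0 mul1r; congr (_ * \det _).
  apply/matrixP => x y; rewrite !mxE lift_perm_lift.
  by rewrite !(inj_eq lift_inj).
case: (unliftP ord0 k) k0 => [y|] ->; last by rewrite eqxx.
by rewrite mxE lift_perm_lift !eq_ord0_lift subr0 mul0r.
Qed.

(** Row [ord0] is [a ord0] times the basis row at [ord0] minus [z ord0] times
the basis row at [L i]. The first term leaves the matrix of [t] in which the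
arc from [i] to [t i] has lost its weight. In the second one, exchanging
columns [ord0] and [L i] absorbs the sign, and what is left is the matrix of
[t] in which the diagonal weight of [i] is lost. *)
Lemma det_weighted_perm_insert n (i : 'I_n) (t : 'S_n) (a z : 'I_n.+1 -> K) :
  \det (weighted_perm_mx (extend_perm (L i) t) a z) =
  a ord0 * \det (weighted_perm_mx t (a \o L)
                   (fun x => if x == t i then 0 else z (L x))) +
  z ord0 * \det (weighted_perm_mx t
                   (fun x => if x == i then 0 else a (L x)) (z \o L)).
Proof.
set s := extend_perm _ _; set B := weighted_perm_mx _ _ _.
pose B_ k0 : 'M[K]_n.+1 :=
  \matrix_(j, k) (if j == ord0 then (k == k0)%:R else B j k).
have row'B k0 : row' ord0 (B_ k0) = row' ord0 B.
  by apply/matrixP => x y; rewrite !mxE eq_lift_ord0.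
have sE x : (ord0 == s x) = (x == L i).
  case: (unliftP ord0 x) => [y|] ->.
    rewrite /s extend_perm_lift (inj_eq lift_inj).
    by case: (eqVneq y i) => // _; rewrite eq_ord0_lift.
  by rewrite /s extend_perm_ord0 !eq_ord0_lift.
rewrite (@determinant_multilinear _ _ B (B_ ord0) (B_ (L i)) ord0
  (a ord0) (- z ord0))//; last first.
  apply/matrixP => x y; rewrite !mxE eqxx sE eq_sym mulNr.
  by rewrite !mulr_natr.
congr (_ + _).
  rewrite det_row0_delta; last by move=> k; rewrite mxE eqxx.
  congr (_ * \det _); apply/matrixP => x y.
  rewrite !mxE eq_lift_ord0 /s extend_perm_lift.
  rewrite (inj_eq lift_inj); congr (_ - _).
  case: (eqVneq y i) => [->|yi].
    by rewrite eq_lift_ord0 mulr0n; case: eqVneq; rewrite ?mul0rn.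
  rewrite (inj_eq lift_inj); case: (eqVneq x (t i)) => // ->.
  by rewrite (inj_eq perm_inj) eq_sym (negbTE yi).
rewrite mulNr -mulrN; congr (_ * _).
transitivity (\det (xcol ord0 (L i) (B_ (L i)))).
  rewrite xcolE det_mulmx det_perm odd_tperm neq_lift.
  by rewrite expr1 mulrN1.
rewrite det_row0_delta; last first.
  move=> k; rewrite !mxE eqxx; congr (_%:R).
  by rewrite -[X in _ == X](tpermL ord0 (L i)) (inj_eq perm_inj).
congr (\det _); apply/matrixP => x y.
rewrite !mxE eq_lift_ord0.
have [->|yi] := eqVneq y i.
  rewrite tpermR /s extend_perm_ord0 (inj_eq lift_inj).
  rewrite eq_lift_ord0 mulr0n.
  by case: (eqVneq x i) => _; rewrite ?mul0rn ?mulr0n.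
rewrite tpermD ?neq_lift// ?(inj_eq lift_inj) 1?eq_sym//.
rewrite /s extend_perm_lift (negbTE yi) !(inj_eq lift_inj).
by case: (eqVneq x i) => // ->; rewrite (eq_sym i) (negbTE yi) !mulr0n.
Qed.

(** Induction by insertion of [ord0]. In the two terms given by
[det_weighted_perm_insert], the factors of the cycles avoiding [i] are those of
[t]; the factor of the cycle of [i] loses one of its two products because one
of its weights is zero. *)
Lemma det_weighted_perm n (s : 'S_n) (a z : 'I_n -> K) :
  \det (weighted_perm_mx s a z) =
  \prod_(C in porbits s) (\prod_(j in C) a j - \prod_(j in C) z j).
Proof.
elim: n s a z => [|n ih] s a z.
  rewrite det_mx00 big1// => C /imsetP[[]]//.
have [f _ fK] := @extend_perm_bij n.
rewrite -(fK s); case: (f s) => j t /=; case: (unliftP ord0 j) => [i|] ->.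
  rewrite det_weighted_perm_insert !ih big_porbits_extend_lift.
  have iC : porbit t i \in porbits t by exact: imset_f.
  rewrite !(bigD1 (porbit t i) iC)/= !mulrA.
  have prodE (f0 : 'I_n.+1 -> K) (C : {set 'I_n}) : i \in C -> \prod_(j in extend_cycle i C) f0 j =
     f0 ord0 * \prod_(j in C) f0 (L j).
    move=> iC'; rewrite /extend_cycle iC' big_setU1 ?ord0_liftset//=.
    by rewrite big_imset//= => x y _ _; exact: lift_inj.
  have prodE' (f0 : 'I_n.+1 -> K) (C : {set 'I_n}) : i \notin C ->
      \prod_(j in extend_cycle i C) f0 j = \prod_(j in C) f0 (L j).
    move=> iC'; rewrite /extend_cycle (negbTE iC').
    by rewrite big_imset//= => x y _ _; exact: lift_inj.
  have prod0 x (f0 : 'I_n -> K) (C : {set 'I_n}) : x \in C ->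
      \prod_(j in C) (if j == x then 0 else f0 j) = 0.
    by move=> xC; rewrite (bigD1 x)//= eqxx mul0r.
  have otherP (C : {set 'I_n}) : (C \in porbits t) && (C != porbit t i) ->
      i \notin C /\ t i \notin C.
    move=> /andP[/imsetP[x _ ->]]; rewrite porbit_step => /negP H.
    by split; rewrite -eq_porbit_mem eq_sym; exact/negP.
  rewrite [X in _ * X + _](_ : _ = \prod_(C in porbits t | C != porbit t i)
      (\prod_(j in extend_cycle i C) a j - \prod_(j in extend_cycle i C) z j)).
    rewrite [X in _ + _ * X](_ : _ = \prod_(C in porbits t | C != porbit t i)
      (\prod_(j in extend_cycle i C) a j - \prod_(j in extend_cycle i C) z j)).
      rewrite -mulrDl; congr (_ * _).
      rewrite !prodE ?porbit_id//=.
      by rewrite !prod0 ?porbit_step ?porbit_id// subr0 sub0r mulrN.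
    apply: eq_bigr => C /otherP[iC' _]; rewrite !prodE'//; congr (_ - _).
    by apply: eq_bigr => x xC; case: eqVneq => // xi; rewrite -xi xC in iC'.
  apply: eq_bigr => C /otherP[iC' tiC]; rewrite !prodE'//; congr (_ - _).
  by apply: eq_bigr => x xC; case: eqVneq => // xi; rewrite -xi xC in tiC.
rewrite extend_perm0 det_weighted_perm_lift ih big_porbits_lift_perm !big_set1.
congr (_ * _); apply: eq_bigr => C _.
by rewrite !big_imset//= => x y _ _; exact: lift_inj.
Qed.

End weighted_det.

Lemma char_poly_perm_cmx (R : realType) n (s : 'S_n) (z : n.-tuple (Cstar R)) :
  char_poly (perm_cmx s z) =
  \prod_(C in porbits s) ('X^#|C| - (\prod_(j in C) cval (tnth z j))%:P).
Proof.
transitivity (\det (weighted_perm_mx s (fun=> 'X) (fun j => (cval (tnth z j))%:P))).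
  congr (\det _); apply/matrixP => j k; rewrite !mxE; congr (_ - _).
  by case: eqP => _; rewrite ?mulr1n ?mulr0n.
rewrite det_weighted_perm; apply: eq_bigr => C _.
by rewrite prodr_const rmorph_prod.
Qed.

(** The algebraic multiplicity of an eigenvalue is the number of its
occurrences in the list of roots. *)
Lemma eigen_measure_prod_XsubC (R : realType) n (M : 'M[R[i]]_n) (rs : seq R[i])
    (A : set R[i]) :
  char_poly M = \prod_(x <- rs) ('X - x%:P) ->
  eigen_measure M A = (\sum_(x <- rs) \d_x A)%E.
Proof.
move=> E; rewrite /eigen_measure.
have -> : [set l | eigenvalue M l] = [set` undup rs].
  by apply/seteqP; split => l /=; rewrite eigenvalue_root_char E root_prod_XsubC
    mem_undup.
rewrite -fsbig_seq ?undup_uniq// -[RHS]big_undup_iterop_count/=.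
apply: eq_bigr => x _; rewrite E mu_prod_XsubC Monoid.iteropE/=.
elim: (count_mem x rs) => [|k ih]; first by rewrite mul0e.
by rewrite iterS -ih -[k.+1]addn1 natrD EFinD ge0_muleDl ?lee_fin// mul1e addeC.
Qed.

(** * Borel measurability of complex arithmetic and of a k-th root *)

Section complex_borel.
Variable R : realType.
Implicit Types (z w : R[i]) (e : R).

Lemma Re_le_normc z : `|complex.Re z| <= complex.Re `|z|.
Proof. by have := normc_ge_Re z; rewrite normc_def lecR. Qed.

Lemma normc_le_ReIm z : `|z| <= (`|complex.Re z| + `|complex.Im z|)%:C.
Proof.
rewrite normc_def lecR -[leRHS]ger0_norm ?addr_ge0// -sqrtr_sqr ler_sqrt ?sqr_ge0//.
rewrite sqrrD !real_normK ?num_real// -addrA lerD2l lerDr.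
by rewrite mulrn_wge0// mulr_ge0.
Qed.

Lemma Im_le_normc z : `|complex.Im z| <= complex.Re `|z|.
Proof.
rewrite normc_def /= -sqrtr_sqr ler_sqrt ?addr_ge0 ?sqr_ge0//.
by rewrite lerDr sqr_ge0.
Qed.

(** The radii in the topology of a numeric field are positive elements of that
field; here they are traded for real ones. *)
Lemma complex_openP (O : set R[i]) : complex_open O <->
  forall z, O z -> exists2 e, 0 < e & forall w, `|z - w| < e%:C -> O w.
Proof.
rewrite /complex_open openE; split => H z Oz.
  have /nbhs_ballP[e /= e0 He] := H z Oz.
  exists (complex.Re e); first by move: e0; rewrite ltcE/= => /andP[].
  move=> w zw; apply: He; rewrite -ball_normE/=.
  by rewrite -[X in _ < X](RRe_real (gtr0_real e0)).
have [e e0 He] := H z Oz.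
apply/nbhs_ballP; exists e%:C => /=; first by rewrite ltcR.
by move=> w; rewrite -ball_normE/= => zw; exact: He.
Qed.

Lemma measurable_Re : measurable_fun [set: R[i]] (@complex.Re R).
Proof.
apply: (measurability _ (RGenOInfty.measurableE R)) => _ [_ [a ->] <-].
rewrite setTI; apply: sub_sigma_algebra; apply/complex_openP => z /=.
rewrite in_itv/= andbT => az; exists (complex.Re z - a); rewrite ?subr_gt0//.
move=> w; rewrite normc_def ltcR => zw; rewrite in_itv/= andbT.
have := Re_le_normc (z - w); rewrite normc_def/= => /le_lt_trans/(_ zw).
case: z w {az zw} => x y [u v] /=; rewrite ltr_norml => /andP[_].
by rewrite ltrD2l ltrN2.
Qed.

Lemma measurable_Im : measurable_fun [set: R[i]] (@complex.Im R).
Proof.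
apply: (measurability _ (RGenOInfty.measurableE R)) => _ [_ [a ->] <-].
rewrite setTI; apply: sub_sigma_algebra; apply/complex_openP => z /=.
rewrite in_itv/= andbT => az; exists (complex.Im z - a); rewrite ?subr_gt0//.
move=> w; rewrite normc_def ltcR => zw; rewrite in_itv/= andbT.
have := Im_le_normc (z - w); rewrite normc_def/= => /le_lt_trans/(_ zw).
case: z w {az zw} => x y [u v] /=; rewrite ltr_norml => /andP[_].
by rewrite ltrD2l ltrN2.
Qed.

Lemma rat_approx (x e : R) : 0 < e -> exists q : rat, `|x - ratr q| < e.
Proof.
move=> e0; have xe : x - e < x + e by lra.
have [q] := rat_in_itvoo xe; rewrite in_itv/= => /andP[qx xq].
by exists q; rewrite ltr_norml; apply/andP; split; lra.
Qed.

Lemma close_to_common (a u p r e : R) :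
  `|a - p| < r -> `|u - p| < r -> r < e / 4 -> `|a - u| < e / 2.
Proof.
rewrite !ltr_norml => /andP[? ?] /andP[? ?] ?.
by apply/andP; split; lra.
Qed.

(** Every open set is a countable union of squares with rational centres and
sides [2 / n.+1]; the preimage of a square only involves the real and imaginary
parts. *)
Lemma measurable_fun_complex d (T : measurableType d) (f : T -> R[i]) :
  measurable_fun setT (fun x => complex.Re (f x)) ->
  measurable_fun setT (fun x => complex.Im (f x)) -> measurable_fun setT f.
Proof.
move=> mRe mIm.
apply: (@measurability _ _ _ _ _ _ (@complex_open R)) => // _ [U oU <-].
rewrite setTI.
pose box (p q : rat) (n : nat) : set R[i] :=
  [set w | `|complex.Re w - ratr p| < n.+1%:R^-1
        /\ `|complex.Im w - ratr q| < n.+1%:R^-1].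
have -> : f @^-1` U = \bigcup_p \bigcup_q \bigcup_n
    (f @^-1` (if `[< box p q n `<=` U >] then box p q n else set0)).
  apply/seteqP; split => x /=; last first.
    by move=> [p _ [q _ [n _]]]; case: ifPn => // /asboolP; exact.
  move=> Ufx; have [e e0 He] := (complex_openP U).1 oU _ Ufx.
  (* Points of a square are within [e / 2] of [f x] in each coordinate, hence
     within [e] for the modulus. *)
  have [n _ Hn] := near_infty_natSinv_lt (PosNum (divr_gt0 e0 (ltr0n _ 4))).
  have {}Hn := Hn n (leqnn n).
  have n0 : (0 : R) < n.+1%:R^-1 by rewrite invr_gt0.
  have [p Hp] := rat_approx (complex.Re (f x)) n0.
  have [q Hq] := rat_approx (complex.Im (f x)) n0.
  exists p => //; exists q => //; exists n => //=.
  case: asboolP => // -[] w [wp wq]; apply: He.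
  apply: (le_lt_trans (normc_le_ReIm _)); rewrite ltcR.
  move: Hp Hq wp wq Hn => /=; case: (f x) w => [a b] [u v] /=.
  move=> ap bq up vq ne; rewrite [ltRHS](splitr e).
  by apply: ltrD; [exact: (close_to_common ap up)|exact: (close_to_common bq vq)].
do 2 (apply: bigcupT_measurable_rat => ?).
apply: bigcupT_measurable => n.
case: ifP => _; last by rewrite preimage_set0.
have mball (g : T -> R) (c r : R) : measurable_fun setT g ->
    measurable [set x | `|g x - c| < r].
  move=> mg; have -> : [set x | `|g x - c| < r] = g @^-1` (ball c r).
    by apply/seteqP; split => x /=; rewrite -ball_normE/= distrC.
  by rewrite -[X in measurable X]setTI; apply: mg => //; exact: measurable_ball.
by apply: measurableI; exact: mball.
Qed.

Lemma measurable_mulc d (T : measurableType d) (f g : T -> R[i]) :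
  measurable_fun setT f -> measurable_fun setT g ->
  measurable_fun setT (fun x => f x * g x).
Proof.
move=> mf mg.
have mRf := measurableT_comp measurable_Re mf.
have mRg := measurableT_comp measurable_Re mg.
have mIf := measurableT_comp measurable_Im mf.
have mIg := measurableT_comp measurable_Im mg.
have ReM (z w : R[i]) : complex.Re (z * w) =
  complex.Re z * complex.Re w - complex.Im z * complex.Im w.
  by case: z w => [a b] [u v].
have ImM (z w : R[i]) : complex.Im (z * w) =
  complex.Re z * complex.Im w + complex.Im z * complex.Re w.
  by case: z w => [a b] [u v].
apply: measurable_fun_complex.
  under eq_fun do rewrite ReM.
  by apply: measurable_funB; exact: measurable_funM.
under eq_fun do rewrite ImM.
by apply: measurable_funD; exact: measurable_funM.
Qed.

Lemma measurable_prodc d (T : measurableType d) I (r : seq I) (P : pred I)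
    (f : I -> T -> R[i]) :
  (forall i, measurable_fun setT (f i)) ->
  measurable_fun setT (fun x => \prod_(i <- r | P i) f i x).
Proof.
move=> mf; elim: r => [|i r ih].
  by under eq_fun do rewrite big_nil; exact: measurable_cst.
under eq_fun do rewrite big_cons.
by case: (P i) => //; exact: measurable_mulc.
Qed.

Definition polar (r u : R) : R[i] := (r * cos u) +i* (r * sin u).

Lemma polarX r u k : polar r u ^+ k = polar (r ^+ k) (u *+ k).
Proof.
elim: k => [|k ih]; first by rewrite !expr0 /polar mulr0n cos0 sin0 mulr1 mulr0.
rewrite exprS ih; apply/eqP; rewrite eq_complex/= mulrS cosD sinD !exprS.
by apply/andP; split; apply/eqP; ring.
Qed.

Definition modc z : R := Num.sqrt (complex.Re z ^+ 2 + complex.Im z ^+ 2).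

(** Half-angle form of the argument: the arctangent is continuous everywhere, so
that measurability is immediate. The formula breaks down only on the closed
negative half-line. *)
Definition argc z : R :=
  if modc z + complex.Re z == 0 then pi
  else atan (complex.Im z / (modc z + complex.Re z)) *+ 2.

Lemma polar_argc z : z != 0 -> polar (modc z) (argc z) = z.
Proof.
move=> z0.
have r0 : modc z != 0.
  rewrite sqrtr_eq0 -ltNge lt_neqAle addr_ge0 ?sqr_ge0// andbT eq_sym.
  rewrite paddr_eq0 ?sqr_ge0// !sqrf_eq0.
  by move: z0; case: z => x y; rewrite eq_complex.
have rxy : modc z ^+ 2 = complex.Re z ^+ 2 + complex.Im z ^+ 2.
  by rewrite sqr_sqrtr// addr_ge0 ?sqr_ge0.
rewrite /argc; case: z z0 r0 rxy => x y /= z0; move: (modc _) => r r0 rxy.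
have [rx|rx] := eqVneq (r + x) 0.
  have xr : x = - r by lra.
  move: rxy; rewrite xr sqrrN => /eqP; rewrite -subr_eq0 opprD addrA subrr sub0r.
  rewrite oppr_eq0 sqrf_eq0 => /eqP ->.
  by rewrite /polar cospi sinpi mulr0 mulrN1.
set t := y / _; rewrite /polar cos_mulr2n sin_mulr2n.
have [/andP[t1 t2] tt] := atan_def t.
have c0 : cos (atan t) != 0 by rewrite gt_eqF// cos_gt0_pihalf// t1 t2.
have s_ : sin (atan t) = t * cos (atan t) by rewrite -[X in _ = X * _]tt /tan divfK.
have c2 : cos (atan t) ^+ 2 = (r + x) / (r *+ 2).
  have := cos2_tan2 c0; rewrite tt => /(congr1 GRing.inv); rewrite invrK => ->.
  have -> : 1 + t ^+ 2 = (r *+ 2) / (r + x); last by rewrite invf_div.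
  have y2 : y ^+ 2 = r ^+ 2 - x ^+ 2 by rewrite rxy addrC addKr.
  by rewrite /t expr_div_n y2; field.
apply/eqP; rewrite eq_complex/=; apply/andP; split; apply/eqP.
  by rewrite c2; field.
rewrite s_ mulrCA -expr2 c2 /t.
by field; rewrite rx r0.
Qed.

(** The square root, like the inverse in the argument, is written as a power in
order to inherit the measurability of power functions. *)
Lemma measurable_modc : measurable_fun setT modc.
Proof.
have -> : modc = fun z =>
    (complex.Re z ^+ 2 + complex.Im z ^+ 2) `^ (2^-1).
  by apply/funext => z; rewrite powR12_sqrt// addr_ge0 ?sqr_ge0.
apply: (measurableT_comp (measurable_powR _)).
by apply: measurable_funD; apply: measurable_funX;
  [exact: measurable_Re|exact: measurable_Im].
Qed.

Lemma measurable_argc : measurable_fun setT argc.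
Proof.
have mD : measurable_fun setT (fun z => modc z + complex.Re z).
  by apply: measurable_funD; [exact: measurable_modc|exact: measurable_Re].
apply: measurable_fun_ifT.
- by apply: measurable_fun_eqr => //; exact: measurable_cst.
- exact: measurable_cst.
have -> : (fun z => atan (complex.Im z / (modc z + complex.Re z)) *+ 2) =
    fun z => 2 * atan (complex.Im z * (modc z + complex.Re z) `^ (-1)).
  apply/funext => z; rewrite powR_inv1 ?mulr_natl// -lerBlDr sub0r.
  rewrite (le_trans (ler_norm _))// normrN.
  by have := Re_le_normc z; rewrite normc_def.
apply: measurable_funM; first exact: measurable_cst.
apply: (measurableT_comp (continuous_measurable_fun (@continuous_atan R))).
apply: measurable_funM; first exact: measurable_Im.
exact: (measurableT_comp (measurable_powR _)).
Qed.

(** An explicit choice of a k-th root, needed because the selection must be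
measurable; an arbitrary root given by algebraic closedness need not be. *)
Definition rootc k z : R[i] := polar (modc z `^ k%:R^-1) (argc z / k%:R).

Lemma rootcK k z : (0 < k)%N -> z != 0 -> rootc k z ^+ k = z.
Proof.
move=> k0 z0; have kn : k%:R != 0 :> R by rewrite pnatr_eq0 -lt0n.
rewrite polarX -powR_mulrn ?powR_ge0// -powRrM mulVf// powRr1 ?sqrtr_ge0//.
by rewrite -(mulr_natr (argc z / _)) divfK// polar_argc.
Qed.

Lemma measurable_rootc k : measurable_fun setT (rootc k).
Proof.
have mr : measurable_fun setT (fun z => modc z `^ k%:R^-1).
  exact: (measurableT_comp (measurable_powR _) measurable_modc).
have ma : measurable_fun setT (fun z => argc z / k%:R).
  by apply: measurable_funM; [exact: measurable_argc|exact: measurable_cst].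
apply: measurable_fun_complex => /=; apply: measurable_funM => //.
  exact: (measurableT_comp (continuous_measurable_fun (@continuous_cos R))).
exact: (measurableT_comp (continuous_measurable_fun (@continuous_sin R))).
Qed.

End complex_borel.

(** * The k-th roots of a complex number *)

Section roots_of_unity.
Variable R : realType.
Implicit Types (z w x : R[i]).

Definition unity_roots k : seq R[i] :=
  sval (closed_field_poly_normal ('X^k - 1 : {poly R[i]})).

Lemma prod_unity_roots k : (0 < k)%N ->
  'X^k - 1 = \prod_(x <- unity_roots k) ('X - x%:P) :> {poly R[i]}.
Proof.
move=> k0; rewrite /unity_roots; case: closed_field_poly_normal => rs /= {1}->.
by rewrite (monicP _) ?scale1r// -polyC1 monicXnsubC.
Qed.

Lemma mem_unity_roots k x : (0 < k)%N -> (x \in unity_roots k) = (x ^+ k == 1).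
Proof.
move=> k0; rewrite -root_prod_XsubC -prod_unity_roots// /root !hornerE.
by rewrite subr_eq0.
Qed.

Lemma uniq_unity_roots k : (0 < k)%N -> uniq (unity_roots k).
Proof.
move=> k0; rewrite -separable_prod_XsubC -prod_unity_roots//.
by rewrite separable_Xn_sub_1// pnatr_eq0 -lt0n.
Qed.

Lemma size_unity_roots k : (0 < k)%N -> size (unity_roots k) = k.
Proof.
move=> k0; apply/eqP; rewrite -eqSS -(size_prod_XsubC _ id) -prod_unity_roots//.
by rewrite -polyC1 size_XnsubC.
Qed.

Definition roots_above k z := [seq x * z | x <- unity_roots k].

Lemma uniq_roots_above k z : (0 < k)%N -> z != 0 -> uniq (roots_above k z).
Proof.
by move=> k0 z0; rewrite map_inj_uniq ?uniq_unity_roots//; exact: mulIf.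
Qed.

Lemma mem_roots_above k z x : (0 < k)%N -> z != 0 ->
  (x \in roots_above k z) = (x ^+ k == z ^+ k).
Proof.
move=> k0 z0; apply/mapP/eqP => [[y + ->]|xz].
  by rewrite mem_unity_roots// exprMn => /eqP ->; rewrite mul1r.
exists (x / z); rewrite ?divfK// mem_unity_roots// exprMn exprVn xz.
by rewrite divff// expf_neq0.
Qed.

Lemma XnsubC_prod k z : (0 < k)%N -> z != 0 ->
  'X^k - (z ^+ k)%:P = \prod_(x <- roots_above k z) ('X - x%:P).
Proof.
move=> k0 z0; rewrite -[RHS]scale1r -(monicP (monicXnsubC (z ^+ k) k0)).
apply: all_roots_prod_XsubC.
- by rewrite size_XnsubC// size_map size_unity_roots.
- by apply/allP => x; rewrite mem_roots_above// /root !hornerE subr_eq0.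
- by rewrite uniq_rootsE uniq_roots_above.
Qed.

Definition root_count k (A : set R[i]) w : \bar R :=
  (\sum_(x <- roots_above k (rootc k w)) \d_x A)%E.

Lemma rootc_neq0 k w : (0 < k)%N -> w != 0 -> rootc k w != 0.
Proof.
move=> k0 w0; apply/eqP => r0; have := rootcK k0 w0.
by rewrite r0 expr0n gtn_eqF// => /esym/eqP; exact/negP.
Qed.

(** The value does not depend on the root used to enumerate the fibre. *)
Lemma root_count_exp k A z : (0 < k)%N -> z != 0 ->
  root_count k A (z ^+ k) = (\sum_(x <- roots_above k z) \d_x A)%E.
Proof.
move=> k0 z0; have zk0 : z ^+ k != 0 by rewrite expf_neq0.
have r0 : rootc k (z ^+ k) != 0 by exact: rootc_neq0.
apply: perm_big; apply: uniq_perm; rewrite ?uniq_roots_above//.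
by move=> x; rewrite !mem_roots_above// rootcK.
Qed.

Lemma root_count_ge0 k A w : (0 <= root_count k A w)%E.
Proof. by apply: sume_ge0 => x _; exact: measure_ge0. Qed.

Lemma measurable_root_count k A : measurable A ->
  measurable_fun setT (root_count k A).
Proof.
move=> mA; rewrite /root_count.
under eq_fun do rewrite big_map.
apply: emeasurable_sum => x.
have -> : (fun w => \d_(x * rootc k w) A) = (fun z => \d_z A) \o (fun w => x * rootc k w).
  by [].
apply: measurableT_comp; first exact: measurable_fun_dirac.
by apply: measurable_mulc; [exact: measurable_cst|exact: measurable_rootc].
Qed.

(** A cycle [C] with product of weights [w] contributes the factor
[X^|C| - w], hence the [|C|]-th roots of [w], each of them once. *)
Lemma eigen_measure_perm_cmx n (s : 'S_n) (z : n.-tuple (Cstar R)) (A : set R[i]) :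
  eigen_measure (perm_cmx s z) A =
  (\sum_(C in porbits s) root_count #|C| A (\prod_(j in C) cval (tnth z j))%R)%E.
Proof.
pose w (C : {set 'I_n}) := \prod_(j in C) cval (tnth z j).
pose rs := [seq x | C : {set 'I_n} <- enum (porbits s),
                x : R[i] <- roots_above #|C| (rootc #|C| (w C))].
rewrite (@eigen_measure_prod_XsubC _ _ _ rs).
  by rewrite big_allpairs_dep/= -big_enum.
rewrite char_poly_perm_cmx big_allpairs_dep/= -big_enum/=.
rewrite big_seq [RHS]big_seq; apply: eq_bigr => C.
rewrite mem_enum => /imsetP[j _ Cj].
have C0 : (0 < #|C|)%N by rewrite Cj lt0n card_porbit_neq0.
have w0 : w C != 0 by apply/prodf_neq0 => x _; exact: cval_neq0.
by rewrite -XnsubC_prod ?rootcK// rootc_neq0.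
Qed.

End roots_of_unity.

(** * Integration lemmas *)

Section eq_off_null.
Import HBNNSimple.

(** The function [f] is not assumed measurable, so that its integral is only a
supremum over the simple functions below it. Such a simple function is almost
everywhere below [g]; and [g], cut to zero on [E], is everywhere below [f]. *)
Lemma integral_eq_off_null d (T : measurableType d) (R : realType)
    (mu : {measure set T -> \bar R}) (E : set T) (f g : T -> \bar R) :
  measurable E -> mu E = 0%E -> (forall x, 0 <= f x)%E -> (forall x, 0 <= g x)%E ->
  measurable_fun setT g -> (forall x, ~ E x -> f x = g x) ->
  (\int[mu]_x f x = \int[mu]_x g x)%E.
Proof.
move=> mE E0 f0 g0 mg fg; apply/eqP; rewrite eq_le; apply/andP; split.
  rewrite [leLHS]ge0_integralTE//; apply: ge_ereal_sup => _ [h hf <-].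
  rewrite -integralT_nnsfun; apply: ae_ge0_le_integral => //.
  - by move=> x _; rewrite lee_fin.
  - exact/measurable_EFinP.
  - exists E; split => // x /= nle; apply: contrapT => nE; apply: nle => _.
    by rewrite -fg.
pose g' x : \bar R := if x \in E then 0%E else g x.
have mg' : measurable_fun setT g'.
  apply: measurable_fun_ifT => //; apply: (measurable_fun_bool true).
  rewrite setTI (_ : _ @^-1` _ = E)//.
  by apply/seteqP; split => x; [exact: set_mem|exact: mem_set].
have -> : (\int[mu]_x g x = \int[mu]_x g' x)%E.
  apply: ge0_ae_eq_integral => //.
  - by move=> x _; rewrite /g'; case: ifP.
  - exists E; split => // x /= ne; apply: contrapT => nE; apply: ne => _.
    by rewrite /g' memNset.
rewrite [leLHS]ge0_integralTE; last by move=> x; rewrite /g'; case: ifP.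
rewrite [leRHS]ge0_integralTE//; apply: le_ereal_sup => _ [h hg' <-].
exists h => // x; apply: (le_trans (hg' x)); rewrite /g'.
by case: ifPn => // /negP nE; rewrite fg// => Ex; apply: nE; rewrite inE.
Qed.

End eq_off_null.

Section iid_integrals.
Context d (T : measurableType d) (R : realType) (L : probability T R).

Lemma integral_iidS n (f : n.+1.-tuple T -> \bar R) :
  measurable_fun setT f -> (forall t, 0 <= f t)%E ->
  (\int[iid L n.+1]_t f t =
   \int[L]_x \int[iid L n]_t f (tuple_cons (x, t)))%E.
Proof.
move=> mf f0; rewrite /= ge0_integral_distribution// fubini_tonelli1//.
  by apply: measurableT_comp => //; exact: measurable_funPT.
by move=> x; exact: f0.
Qed.

End iid_integrals.

Section cstar.
Variable R : realType.

Lemma measurable_cval : measurable_fun setT (@cval R).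
Proof.
move=> _ A mA; rewrite setTI; apply: sub_sigma_algebra.
by exists A => //; rewrite setTI.
Qed.

Lemma measurable_fun_Cstar d (T : measurableType d) (f : T -> Cstar R) :
  measurable_fun setT (fun x => cval (f x)) -> measurable_fun setT f.
Proof.
move=> mf; apply: (@measurability _ _ _ _ _ _ (@cval_preimage R)) => //.
move=> _ [_ [B mB <-] <-]; rewrite !setTI -[X in measurable X]setTI; exact: mf.
Qed.

Lemma measurable_prod_tnth n (P : pred 'I_n) :
  measurable_fun setT
    (fun t : n.-tuple (Cstar R) => \prod_(j < n | P j) cval (tnth t j)).
Proof.
apply: measurable_prodc => j.
by apply: measurableT_comp; [exact: measurable_cval|exact: measurable_tnth].
Qed.

Variable L : probability (Cstar R) R.

(** Products of [#|C|] of the coefficients all have the same law, whichever the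
positions. Induction on [n]: the first coefficient is integrated out when it
is not in [C], and is moved into [f] when it is. *)
Lemma integral_iid_prod n (C : {set 'I_n}) (f : R[i] -> \bar R) :
  measurable_fun setT f -> (forall w, 0 <= f w)%E ->
  (\int[iid L n]_t f (\prod_(j in C) cval (tnth t j))%R =
   \int[iid L #|C|]_t f (\prod_(j < #|C|) cval (tnth t j))%R)%E.
Proof.
elim: n C f => [|n ih] C f mf f0.
  have -> : #|C| = 0%N by apply: eq_card0 => -[].
  by apply: eq_integral => t _; rewrite !big1// => -[].
pose C' := [set j | lift ord0 j \in C]%SET.
have cardC : #|C| = ((ord0 \in C) + #|C'|)%N.
  rewrite -!sum1_card big_mkcond big_ord_recl/=; congr addn.
  by rewrite [RHS]big_mkcond; apply: eq_bigr => j _; rewrite inE.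
have prodC (x : Cstar R) (t : n.-tuple (Cstar R)) :
    \prod_(j in C) cval (tnth (tuple_cons (x, t)) j) =
    (if ord0 \in C then cval x else 1) * \prod_(j in C') cval (tnth t j).
  rewrite big_mkcond big_ord_recl/=; congr (_ * _).
  by rewrite [RHS]big_mkcond; apply: eq_bigr => j _; rewrite inE tnthS.
rewrite integral_iidS//; last first.
  by apply: measurableT_comp => //; exact: measurable_prod_tnth.
have mfx (c : R[i]) : measurable_fun setT (fun w => f (c * w)).
  by apply: measurableT_comp => //; apply: measurable_mulc;
    [exact: measurable_cst|exact: measurable_id].
transitivity (\int[L]_x \int[iid L n]_t
    f ((if ord0 \in C then cval x else 1) * \prod_(j in C') cval (tnth t j))%R)%E.
  by apply: eq_integral => x _; apply: eq_integral => t _; rewrite prodC.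
rewrite cardC; case: (ord0 \in C) => /=.
  rewrite integral_iidS//; last first.
    by apply: measurableT_comp => //; exact: measurable_prod_tnth.
  apply: eq_integral => x _; rewrite (ih C' (fun w => f (cval x * w)))//.
  apply: eq_integral => t _; rewrite big_ord_recl; congr (f (_ * _)).
  by apply: eq_bigr => j _; rewrite tnthS.
transitivity (\int[L]_x (cst (\int[iid L #|C'|]_t
    f (\prod_(j < #|C'|) cval (tnth t j))%R) x))%E.
  apply: eq_integral => x _; rewrite /= -ih//.
  by apply: eq_integral => t _; rewrite mul1r.
by rewrite integral_cst// [X in (_ * X)%E]probability_setT mule1.
Qed.

End cstar.

(** * The laws [root_law L k] *)

Section root_law.
Context (R : realType) (L : probability (Cstar R) R).

Definition tuple_prod k (t : k.-tuple (Cstar R)) : R[i] :=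
  \prod_(i < k) cval (tnth t i).

Lemma measurable_tuple_prod k : measurable_fun setT (@tuple_prod k).
Proof. exact: measurable_prod_tnth. Qed.

(** Only the two defining properties of [nu] are used, so the measure selected by
[root_law] need not be known explicitly. The law of the product is the image
of [nu] by the k-th power, and the k-th roots of [z ^+ k] are the [x * z] with
[x ^+ k = 1]; each of these has law [nu] by invariance. *)
Lemma integral_root_count k (nu : probability (Cstar R) R) (A : set R[i]) :
  (0 < k)%N -> is_root_law L k nu -> measurable A ->
  (\int[iid L k]_t root_count k A (tuple_prod t) =
   k%:R%:E * pushforward nu (@cval R) A)%E.
Proof.
move=> k0 [inv powk] mA.
have mpow : measurable_fun setT (fun z : Cstar R => cval z ^+ k).
  have -> : (fun z : Cstar R => cval z ^+ k) = fun z => \prod_(i < k) cval z.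
    by apply/funext => z; rewrite prodr_const card_ord.
  by apply: measurable_prodc => _; exact: measurable_cval.
have mrc := measurable_root_count k mA.
transitivity (\int[pushforward (iid L k) (@tuple_prod k)]_w root_count k A w)%E.
  rewrite ge0_integral_pushforward//; first exact: measurable_tuple_prod.
  by move=> w _; exact: root_count_ge0.
transitivity (\int[pushforward nu (fun z => (cval z ^+ k)%R)]_w root_count k A w)%E.
  apply: eq_measure_integral => [|mt B mB _]; first exact: measurable_tuple_prod.
  exact: (esym (powk B mB)).
rewrite ge0_integral_pushforward//; last by move=> w _; exact: root_count_ge0.
rewrite preimage_setT.
have mmul (x : R[i]) : measurable_fun setT (fun z : Cstar R => x * cval z).
  by apply: measurable_mulc; [exact: measurable_cst|exact: measurable_cval].
under eq_integral => z _.
  rewrite /= root_count_exp// ?cval_neq0// big_map; over.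
rewrite ge0_integral_sum//; last first.
  move=> x; apply: (measurableT_comp (f := fun z : R[i] => \d_z A)) (mmul x).
  exact: measurable_fun_dirac.
rewrite big_seq.
transitivity (\sum_(x <- unity_roots R k | x \in unity_roots R k)
   pushforward nu (@cval R) A)%E.
  apply: eq_bigr => x; rewrite mem_unity_roots// => /eqP xk.
  rewrite -(inv x xk A mA) /pushforward.
  set B := _ @^-1` A; have mB : measurable B.
    by rewrite -[B]setTI; exact: mmul.
  by rewrite -[B]setIT -(integral_indic nu _ mB).
rewrite -big_seq -[in RHS](size_unity_roots R k0).
elim: (unity_roots R k) => [|x rs ih]; first by rewrite big_nil mul0e.
rewrite big_cons ih /= -[(size rs).+1]add1n natrD EFinD.
by rewrite ge0_muleDl ?lee_fin// mul1e.
Qed.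

End root_law.

(** Existence: take a k-th root of a product of [k] independent variables and
multiply it by a uniformly random k-th root of unity. The parameter [k] stands
for [k.+1], which makes the exponent nonzero without a hypothesis. *)
Section root_law_existence.
Context (R : realType) (L : probability (Cstar R) R) (k : nat).

Lemma tuple_prod_neq0 n (t : n.-tuple (Cstar R)) : tuple_prod t != 0.
Proof. by apply/prodf_neq0 => j _; exact: cval_neq0. Qed.

(* The default value [1] keeps the values nonzero for every index, as the finite
   sums of measures range over sequences indexed by all natural numbers. *)
Let zeta (i : nat) := nth 1 (unity_roots R k.+1) i.

Lemma zeta_neq0 i : zeta i != 0.
Proof.
rewrite /zeta; have [ik|ki] := ltnP i (size (unity_roots R k.+1)).
  have := mem_nth 1 ik; rewrite mem_unity_roots//.
  by apply: contraTneq => ->; rewrite expr0n eq_sym oner_eq0.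
by rewrite nth_default// oner_eq0.
Qed.

Lemma root_map_subproof i (t : k.+1.-tuple (Cstar R)) :
  zeta i * rootc k.+1 (tuple_prod t) != 0.
Proof. by rewrite mulf_neq0 ?zeta_neq0 ?rootc_neq0 ?tuple_prod_neq0. Qed.

Definition root_map i t : Cstar R := MkCstar (root_map_subproof i t).

Lemma measurable_root_map i : measurable_fun setT (root_map i).
Proof.
apply: measurable_fun_Cstar; apply: measurable_mulc; first exact: measurable_cst.
apply: (measurableT_comp (f := rootc k.+1)); first exact: measurable_rootc.
exact: measurable_tuple_prod.
Qed.

HB.instance Definition _ i :=
  isMeasurableFun.Build _ _ _ _ (root_map i) (measurable_root_map i).

Let k1_ge0 : 0 <= k.+1%:R^-1 :> R. Proof. by rewrite invr_ge0. Qed.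

Definition root_average : set (Cstar R) -> \bar R :=
  mscale (NngNum k1_ge0)
    (msum (fun i => distribution (iid L k.+1) (root_map i)) k.+1).

HB.instance Definition _ := Measure.on root_average.

Let root_average_setT : root_average setT = 1%E.
Proof.
rewrite /root_average /mscale /= /msum.
rewrite (eq_bigr (fun=> 1%E)) => [|i _]; last exact: probability_setT.
rewrite sumEFin sumr_const card_ord -EFinM.
by rewrite mulVf// pnatr_eq0.
Qed.

HB.instance Definition _ :=
  Measure_isProbability.Build _ _ _ root_average root_average_setT.

Lemma root_averageE (f : Cstar R -> R[i]) (A : set R[i]) :
  pushforward root_average f A =
  (k.+1%:R^-1%:E *
   \sum_(i < k.+1) iid L k.+1 ((f \o root_map i) @^-1` A))%E.
Proof. by []. Qed.

Lemma is_root_law_average : is_root_law L k.+1 root_average.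
Proof.
split => [w wk A mA|A mA].
  rewrite !root_averageE; congr (_ * _)%E.
  pose h x := iid L k.+1
    [set t | A (x * rootc k.+1 (tuple_prod t))].
  have sumE (g : R[i] -> \bar R) :
      (\sum_(i < k.+1) g (zeta i) = \sum_(x <- unity_roots R k.+1) g x)%E.
    by rewrite (big_nth 1) big_mkord size_unity_roots.
  transitivity (\sum_(i < k.+1) h (zeta i * w)%R)%E.
    apply: eq_bigr => i _; congr (iid _ _ _).
    by apply/seteqP; split => t /=; rewrite mulrA [w * _]mulrC.
  rewrite (sumE (fun x => h (x * w))) [RHS](sumE h).
  have w0 : w != 0.
    by apply: contra_eq_neq wk => ->; rewrite expr0n eq_sym oner_neq0.
  rewrite -(big_map (fun x => x * w) xpredT h); apply: perm_big.
  apply: uniq_perm; rewrite ?uniq_unity_roots ?uniq_roots_above//.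
  by move=> x; rewrite mem_roots_above// mem_unity_roots// wk.
rewrite root_averageE.
transitivity (k.+1%:R^-1%:E * \sum_(i < k.+1) mulconv_pow L k.+1 A)%E.
  congr (_ * _)%E; apply: eq_bigr => i _; congr (iid _ _ _).
  have zk : zeta i ^+ k.+1 = 1.
    by apply/eqP; rewrite -mem_unity_roots// mem_nth// size_unity_roots.
  apply/seteqP; split => t /=;
  by rewrite exprMn zk mul1r rootcK ?tuple_prod_neq0.
rewrite /mulconv_pow /pushforward; set B := _ @^-1` A.
have Bfin : iid L k.+1 B \is a fin_num.
  apply: fin_num_measure; rewrite -[B]setTI.
  exact: (measurable_tuple_prod measurableT).
rewrite -(fineK Bfin) sumEFin sumr_const card_ord -EFinM.
by rewrite -(mulr_natl (fine _)) mulKf// pnatr_eq0.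
Qed.

End root_law_existence.

Lemma root_lawP (R : realType) (L : probability (Cstar R) R) k : (0 < k)%N ->
  is_root_law L k (root_law L k).
Proof.
case: k => // k _; rewrite /root_law.
by apply: getPex; exists (root_average L k : probability (Cstar R) R); exact: is_root_law_average.
Qed.

(** * Random permutation matrices *)

Section ewens_integral.
Context (R : realType) (N : nat) (theta : {posnum R}).

Lemma integral_ewens (f : 'S_N -> \bar R) : (forall s, 0 <= f s)%E ->
  (\int[ewens theta]_s f s = \sum_(s : 'S_N) (ewens_pmf theta s)%:E * f s)%E.
Proof.
move=> f0.
have mS (g : 'S_N -> \bar R) : measurable_fun setT g by move=> _ B _.
transitivity (\int[ewens theta]_s \sum_t f t * (\1_[set t] s)%:E)%E.
  apply: eq_integral => s _; rewrite (bigD1 s)//= big1 => [|t ts].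
    by rewrite adde0 indicE mem_set// mule1.
  by rewrite indicE memNset ?mule0//= => st; rewrite st eqxx in ts.
rewrite ge0_integral_sum//; last first.
  by move=> t s _; rewrite mule_ge0// lee_fin.
apply: eq_bigr => t _; rewrite ge0_integralZl//.
rewrite integral_indic// setIT muleC; congr (_ * _)%E.
rewrite /= /ewens (bigD1 t)//= big1 ?adde0 => [|s st].
  by rewrite diracE mem_set// mule1.
by rewrite diracE memNset ?mule0// => /= ts; rewrite ts eqxx in st.
Qed.

End ewens_integral.

Section matrix_measurability.
Context d (T : measurableType d) (m n : nat).

Lemma measurable_entry (i : 'I_m) (j : 'I_n) :
  measurable_fun setT (fun M : 'M[T]_(m, n) => M i j).
Proof.
move=> _ A mA; rewrite setTI; apply: sub_sigma_algebra.
by exists i, j, A.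
Qed.

Lemma measurable_fun_mx d' (U : measurableType d') (f : U -> 'M[T]_(m, n)) :
  (forall i j, measurable_fun setT (fun x => f x i j)) -> measurable_fun setT f.
Proof.
move=> mf; apply: (@measurability _ _ _ _ _ _ (@entry_cylinders d T m n)) => //.
move=> _ [_ [i [j [A mA ->]]] <-]; exact: mf.
Qed.

End matrix_measurability.

Section permutation_matrices.
Context (R : realType) (N : nat).

Lemma measurable_perm_cmx :
  measurable_fun setT (fun x : 'S_N * N.-tuple (Cstar R) => perm_cmx x.1 x.2).
Proof.
apply: measurable_fun_mx => j k.
have -> : (fun x : 'S_N * N.-tuple (Cstar R) => perm_cmx x.1 x.2 j k) =
    fun x => if j == x.1 k then cval (tnth x.2 j) else 0.
  by apply/funext => x; rewrite mxE.
apply: measurable_fun_ifT.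
- apply: (measurableT_comp (f := fun s : 'S_N => j == s k)) => //.
- apply: (measurableT_comp (@measurable_cval R)).
  exact: (measurableT_comp (measurable_tnth j)).
- exact: measurable_cst.
Qed.

(** The set of matrices [perm_cmx s z], described by entrywise conditions. *)
Definition perm_pattern (s : 'S_N) : set 'M[R[i]]_N :=
  [set M | forall j k, (M j k == 0) = (j != s k)].

Lemma measurable_perm_pattern s : measurable (perm_pattern s).
Proof.
have m0 : measurable [set 0 : R[i]].
  have -> : [set 0 : R[i]] = (@complex.Re R @^-1` [set 0]) `&` (@complex.Im R @^-1` [set 0]).
    apply/seteqP; split => [_ ->//|[x y] /= [-> ->]//].
  apply: measurableI; rewrite -[X in measurable X]setTI.
    by apply: measurable_Re => //; exact: measurable_set1.
  by apply: measurable_Im => //; exact: measurable_set1.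
have -> : perm_pattern s = \bigcap_(j in setT) \bigcap_(k in setT)
    ((fun M : 'M[R[i]]_N => M j k) @^-1`
       (if j != s k then [set 0] else ~` [set 0])).
  apply/seteqP; split => M /=.
    move=> sM j _ k _ /=; have := sM j k.
    by case: ifP => _ /eqP.
  move=> sM j k; have := sM j Logic.I k Logic.I => /=.
  by case: ifP => _ /eqP // /negbTE.
apply: fin_bigcap_measurable => // j _; apply: fin_bigcap_measurable => // k _.
rewrite -[X in measurable X]setTI; apply: measurable_entry => //.
by case: ifP => _ //; exact: measurableC.
Qed.

Lemma perm_cmx_pattern (s s' : 'S_N) (z : N.-tuple (Cstar R)) :
  perm_pattern s' (perm_cmx s z) <-> s' = s.
Proof.
split => [H|->].
  apply/permP => k; apply/eqP; rewrite eq_sym; apply/negPn.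
  rewrite -(H (s k) k) mxE eqxx; exact: cval_neq0.
move=> j k; rewrite mxE; case: ifP => _; last by rewrite eqxx.
by rewrite (negbTE (cval_neq0 _)).
Qed.

Lemma perm_patternP (s : 'S_N) M : perm_pattern s M -> exists z, M = perm_cmx s z.
Proof.
move=> sM.
have nz j : M j (s^-1%g j) != 0 by rewrite sM permKV eqxx.
exists [tuple MkCstar (nz j) | j < N].
apply/matrixP => j k; rewrite mxE tnth_mktuple/=; case: eqP => [->|/eqP jsk].
  by rewrite permK.
by apply/eqP; rewrite sM.
Qed.

(** A visibly measurable function on all matrices which coincides with the
eigenvalue count on permutation matrices: the weights of the cycles are read
off the entries at positions [(j, s^-1 j)]. *)
Definition cycle_root_count (A : set R[i]) (M : 'M[R[i]]_N) : \bar R :=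
  (\sum_(s : 'S_N) (\1_(perm_pattern s) M)%:E *
     \sum_(C in porbits s)
        root_count #|C| A (\prod_(j in C) M j (s^-1%g j))%R)%E.

Lemma cycle_root_count_ge0 A M : (0 <= cycle_root_count A M)%E.
Proof.
apply: sume_ge0 => s _; apply: mule_ge0; first by rewrite lee_fin.
by apply: sume_ge0 => C _; exact: root_count_ge0.
Qed.

Lemma measurable_cycle_root_count A : measurable A ->
  measurable_fun setT (cycle_root_count A).
Proof.
move=> mA; apply: emeasurable_sum => s; apply: emeasurable_funM.
  by apply/measurable_EFinP; exact: measurable_indic (measurable_perm_pattern s).
under eq_fun do rewrite -big_enum.
apply: emeasurable_sum => C.
apply: (measurableT_comp (measurable_root_count #|C| mA)).
by apply: measurable_prodc => j; exact: measurable_entry.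
Qed.

Lemma cycle_root_countE A s z :
  cycle_root_count A (perm_cmx s z) = eigen_measure (perm_cmx s z) A.
Proof.
rewrite /cycle_root_count (bigD1 s)//= [X in (_ + X)%E]big1 ?adde0 => [|s' s's].
  rewrite indicE mem_set ?mul1e; last exact/perm_cmx_pattern.
  rewrite eigen_measure_perm_cmx; apply: eq_bigr => C _; congr (root_count _ _ _).
  by apply: eq_bigr => j _; rewrite mxE permKV eqxx.
rewrite indicE memNset ?mul0e// => /perm_cmx_pattern E.
by rewrite E eqxx in s's.
Qed.

End permutation_matrices.

(** * The expected spectral measure *)

Lemma sum_porbits_card (V : nmodType) n (s : 'S_n) (v : nat -> V) :
  \sum_(C in porbits s) v #|C| *+ #|C| = \sum_(j < n) v #|porbit s j|.
Proof.
rewrite [RHS](partition_big_imset (porbit s))/=; apply: eq_bigr => C /imsetP[x _ ->].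
rewrite (eq_bigr (fun=> v #|porbit s x|)) => [|j /eqP -> //].
rewrite sumr_const; congr (_ *+ _); apply: eq_card => j.
by rewrite -eq_porbit_mem unfold_in.
Qed.

Lemma ffact_prodB (K : comNzRingType) n k : (k <= n)%N ->
  (n ^_ k)%:R = \prod_(0 <= i < k) (n%:R - i%:R) :> K.
Proof.
elim: k => [|k ih] kn; first by rewrite big_geq.
by rewrite ffactnSr natrM ih ?(ltnW kn)// big_nat_recr//= natrB// ltnW.
Qed.

Section expectation.
Context (R : realType) (theta : {posnum R}).

Lemma rising_gt0 n : 0 < rising theta%:num n.
Proof. by apply: prodr_gt0 => i _; rewrite ltr_wpDr. Qed.

Lemma rising_split n k : (k <= n)%N ->
  rising theta%:num n = rising theta%:num (n - k) *
    \prod_(1 <= i < k.+1) (n%:R - i%:R + theta%:num).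
Proof.
elim: k => [|k ih] kn; first by rewrite big_geq// subn0 mulr1.
rewrite ih ?(ltnW kn)// [in RHS]big_nat_recr//= -(subnSK kn).
rewrite [X in X * _ = _]/rising big_ord_recr/= -/(rising _ _) natrB//.
by rewrite -mulrA [in RHS](mulrC (\prod_(_ <= _ < _) _)) [in RHS](addrC _ theta%:num).
Qed.

Lemma ewens_cycle_stat n (v : nat -> R) :
  \sum_(s : 'S_n) ewens_pmf theta s * \sum_(j < n) v #|porbit s j| =
  theta%:num * \sum_(1 <= k < n.+1)
     ((\prod_(0 <= i < k) (n%:R - i%:R)) /
      (\prod_(1 <= i < k.+1) (n%:R - i%:R + theta%:num))) * v k.
Proof.
transitivity (cycle_stat theta%:num n v / rising theta%:num n).
  rewrite /cycle_stat mulr_suml; apply: eq_bigr => s _.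
  by rewrite /ewens_pmf sum_theta_cycles mulrAC.
rewrite cycle_statE -mulrA; congr (_ * _).
rewrite big_add1/= big_mkord mulr_suml; apply: eq_bigr => k _.
have := rising_gt0 n; rewrite ffact_prodB// (rising_split (ltn_ord k)).
have := rising_gt0 (n - k.+1); move: (rising _ _) (\prod_(1 <= _ < _) _) => r D r0.
rewrite pmulr_rgt0// => D0; field.
by rewrite !gt_eqF.
Qed.

(** A cycle of length [k] contributes [k] times the mass of [root_law L k], that
is, once this mass for each of its points. *)
Lemma integral_iid_eigen_measure N (s : 'S_N) (L : probability (Cstar R) R)
    (A : set R[i]) : measurable A ->
  (\int[iid L N]_z eigen_measure (perm_cmx s z) A =
   (\sum_(j < N) fine (pushforward (root_law L #|porbit s j|) (@cval R) A))%:E)%E.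
Proof.
move=> mA.
under eq_integral => z _ do rewrite eigen_measure_perm_cmx -big_enum.
rewrite ge0_integral_sum//; first last.
- by move=> C z _; exact: root_count_ge0.
- move=> C; apply: (measurableT_comp (measurable_root_count #|C| mA)).
  exact: measurable_prod_tnth.
rewrite big_enum/= -(sum_porbits_card s
  (fun k => fine (pushforward (root_law L k) (@cval R) A))) -sumEFin.
apply: eq_bigr => C /imsetP[x _ ->]; set k := #|_|.
have k0 : (0 < k)%N by rewrite lt0n card_porbit_neq0.
rewrite integral_iid_prod; [|exact: measurable_root_count|exact: root_count_ge0].
rewrite (integral_root_count k0 (root_lawP L k0) mA) -(mulr_natl (fine _)) EFinM fineK//.
apply: fin_num_measure; rewrite -[X in measurable X]setTI.
exact: measurable_cval.
Qed.

End expectation.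

Theorem proposition3p12 (R : realType) (N : nat) (N_ge1 : (1 <= N)%N)
    (theta : {posnum R}) (L : probability (Cstar R) R)
    (d : measure_display) (Omega : measurableType d) (P : probability Omega R)
    (M_N : {RV P >-> 'M[R[i]]_N})
    (M_N_law : forall B : set 'M[R[i]]_N, measurable B ->
       distribution P M_N B = perm_cmx_law theta L B)
    (A : set R[i]) (mA : measurable A) :
  expected_eigen_measure P M_N A =
  (theta%:num%:E * \sum_(1 <= k < N.+1)
     ((\prod_(0 <= i < k) (N%:R - i%:R)) /
      (\prod_(1 <= i < k.+1) (N%:R - i%:R + theta%:num)))%:E
     * pushforward (root_law L k) (@cval R) A)%E.
Proof.
rewrite /expected_eigen_measure.
(* [M_N] almost surely takes its values in [B], on which the eigenvalue count is
   the measurable function [cycle_root_count]. *)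
pose B : set 'M[R[i]]_N := \bigcup_(s in setT) perm_pattern s.
have mB : measurable B.
  by apply: fin_bigcup_measurable => [|s _]; [exact: finite_finset|exact: measurable_perm_pattern].
have mH := @measurable_cycle_root_count R N A mA.
have H0 := @cycle_root_count_ge0 R N A.
have mX := @measurable_perm_cmx R N.
transitivity (\int[P]_w cycle_root_count A (M_N w))%E.
  apply: (@integral_eq_off_null _ _ _ P (M_N @^-1` (~` B))) => //.
  - by rewrite -[X in measurable X]setTI; apply: measurable_funPT => //; exact: measurableC.
  - transitivity (perm_cmx_law theta L (~` B)); first by rewrite -M_N_law//; exact: measurableC.
    rewrite /perm_cmx_law /pushforward (_ : _ @^-1` _ = set0) ?measure0//.
    apply/seteqP; split => // -[s z] /=; apply; exists s => //.
    exact/perm_cmx_pattern.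
  - move=> w; apply: fsume_ge0 => l _; apply: mule_ge0; first by rewrite lee_fin.
    exact: measure_ge0.
  - by apply: measurableT_comp => //; exact: measurable_funPT.
  - move=> w /contrapT[s _ /perm_patternP[z ->]].
    by rewrite cycle_root_countE.
rewrite -[LHS](@ge0_integral_distribution _ _ _ _ _ P M_N (cycle_root_count A))//.
transitivity (\int[pushforward (ewens theta \x iid L N)%E
   (fun x => perm_cmx x.1 x.2)]_M cycle_root_count A M)%E.
  apply: eq_measure_integral => C mC _; exact: M_N_law.
rewrite ge0_integral_pushforward// preimage_setT fubini_tonelli1//; last first.
- by move=> x; exact: H0.
- exact: measurableT_comp.
under eq_integral => s _.
  rewrite (_ : fubini_F _ _ _ = (\sum_(j < N)
    fine (pushforward (root_law L #|porbit s j|) (@cval R) A))%:E).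
    over.
  rewrite -integral_iid_eigen_measure//; apply: eq_integral => z _.
  by rewrite /= cycle_root_countE.
pose v k := fine (pushforward (root_law L k) (@cval R) A).
have v0 k : 0 <= v k.
  by apply: fine_ge0; rewrite /pushforward; exact: measure_ge0.
rewrite integral_ewens; last by move=> s; rewrite lee_fin; apply: sumr_ge0 => j _; exact: v0.
transitivity (\sum_(s : 'S_N) ewens_pmf theta s * \sum_(j < N) v #|porbit s j|)%:E.
  by rewrite -sumEFin; apply: eq_bigr => s _; rewrite EFinM.
rewrite ewens_cycle_stat EFinM -sumEFin; congr (_ * _)%E.
apply: eq_bigr => k _; rewrite EFinM fineK//.
apply: fin_num_measure; rewrite -[X in measurable X]setTI.
exact: measurable_cval.
Qed.
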